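(* The following two problems each strongly $N$-reduce to the other: (i) for every $Y^{2}$ there is $X\subseteq\mathbb{N}$ with $X=J(Y)$, where $J(Y):=\{n\in\mathbb{N} : (\exists f\in\mathbb{N}^{\mathbb{N}})(Y(f,n)=0)\}$; (ii) every monotone (increasing) net in Cantor space $C=2^{\mathbb{N}}$, ordered lexicographically by $\leq_{\textsf{lex}}$, and indexed by Baire space, has a limit.
   Context: Work in the language of higher-order arithmetic: objects of type $0$ are natural numbers, of type $1$ elements of Baire space $\mathbb{N}^{\mathbb{N}}$, of type $2$ functionals $Y:\mathbb{N}^{\mathbb{N}}\to\mathbb{N}$; a functional of two arguments $Y(f,n)$ is understood via standard pairing as a type-2 object. Subsets of $\mathbb{N}$ and of $\mathbb{N}^{\mathbb{N}}$ are given by characteristic functions. A ''problem'' is a statement of the form $(\forall Y^{2})(\exists x^{1})A(Y,x)$ (parameters of higher type such as nets, sets, functions $[0,1]\to\mathbb{R}$ are coded as type-2 objects, and outputs such as reals, subsets of $\mathbb{N}$ or finite sequences of reals are coded as type-1 objects). For problems $P_A\equiv(\forall Y^{2})(\exists x^{1})A(Y,x)$ and $P_B\equiv(\forall Z^{2})(\exists y^{1})B(Z,y)$, say that $P_B$ $N$-reduces to $P_A$ if there are an index $e\in\mathbb{N}$ and terms $s^{2\to1}$, $t^{2\to2}$ of Gödel's system $T$ such that $(\forall Z^{2},x^{1})\big[A(t(Z),x)\to[\{e\}^{s(Z,x)}\downarrow\wedge B(Z,\{e\}^{s(Z,x)})]\big]$, where $\{e\}^{X}$ is the $e$-th Turing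 machine with oracle $X$ (computing an element of $\mathbb{N}^{\mathbb{N}}$, with $\downarrow$ meaning it is total). The reduction is strong if $s(Z,x)$ can be taken of the form $u(x)$ for a term $u$ of Gödel's $T$ not depending on $Z$. A directed set is a nonempty $D$ with a transitive, reflexive relation $\preceq$ such that any two elements have a common upper bound; a net in $X$ is a map $x:D\to X$, written $(x_d)_{d\in D}$; it converges to $y$ (its limit) if for every neighbourhood $U$ of $y$ there is $d_0\in D$ with $x_e\in U$ for all $e\succeq d_0$. A net is indexed by Baire space if $D\subseteq\mathbb{N}^{\mathbb{N}}$ (with $\preceq$ given as a functional). A net $f_d:D\to C$ is increasing if $a\preceq b$ implies $f_a\leq_{\textsf{lex}} f_b$. *)

(* Defs.v *)
From HB Require Import structures.
From mathcomp Require Import all_boot.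
From mathcomp Require Import boolp classical_sets topology cantor.

Set Implicit Arguments.
Unset Strict Implicit.
Unset Printing Implicit Defensive.

Local Open Scope classical_set_scope.

(** * Gödel's system T, interpreted in the full type structure over [nat] *)

Inductive ty : Set := Nat | Arr of ty & ty.

Fixpoint ty_sem (a : ty) : Set :=
  match a with
  | Nat => nat
  | Arr a b => ty_sem a -> ty_sem b
  end.

Definition ty1 : ty := Arr Nat Nat.
Definition ty2 : ty := Arr ty1 Nat.

Definition type1 : Set := nat -> nat.
Definition type2 : Set := type1 -> nat.

(* Typed de Bruijn indices. *)
Inductive var : seq ty -> ty -> Set :=
| VZ G a : var (a :: G) a
| VS G a b : var G a -> var (b :: G) a.

Inductive term : seq ty -> ty -> Set :=
| Var G a : var G a -> term G a
| App G a b : term G (Arr a b) -> term G a -> term G b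
| Lam G a b : term (a :: G) b -> term G (Arr a b)
| Zero G : term G Nat
| Succ G : term G (Arr Nat Nat)
| Rec G a : term G (Arr a (Arr (Arr Nat (Arr a a)) (Arr Nat a))).

Fixpoint env (G : seq ty) : Set :=
  if G is a :: G' then (ty_sem a * env G')%type else unit.

Fixpoint var_sem G a (v : var G a) : env G -> ty_sem a :=
  match v in var G a return env G -> ty_sem a with
  | VZ _ _ => fun r => r.1
  | VS _ _ _ v' => fun r => var_sem v' r.2
  end.

Fixpoint rec_sem (A : Set) (x : A) (g : nat -> A -> A) (n : nat) : A :=
  if n is m.+1 then g m (rec_sem x g m) else x.

Fixpoint term_sem G a (t : term G a) : env G -> ty_sem a :=
  match t in term G a return env G -> ty_sem a with
  | Var _ _ v => var_sem v
  | App _ _ _ f u => fun r => term_sem f r (term_sem u r)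
  | Lam _ _ _ f => fun r x => term_sem f (x, r)
  | Zero _ => fun _ => 0
  | Succ _ => fun _ n => n.+1
  | Rec _ a => fun _ => @rec_sem (ty_sem a)
  end.

Definition closed_term (a : ty) : Set := term [::] a.

Definition interp (a : ty) (t : closed_term a) : ty_sem a := term_sem t tt.

(** * Oracle Turing machines

  Deterministic machines with a work tape and an oracle tape, both two-way
  infinite.  Symbols and states are natural numbers, 0 being both the blank
  symbol and the initial state; a finite program mentions only finitely many
  of them. *)

Inductive move : Set := MLeft | MStay | MRight.

(* [Write a b m m'] writes [a] on the work tape and [b] on the oracle tape,
   then moves the two heads according to [m] and [m'] respectively. *)
Inductive action : Set :=
| Write of nat & nat & move & move
| Query.

Definition move_code (m : move) : option bool :=
  match m with MLeft => Some false | MStay => None | MRight => Some true end.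
Definition move_decode (o : option bool) : move :=
  match o with Some false => MLeft | None => MStay | Some true => MRight end.
Lemma move_codeK : cancel move_code move_decode. Proof. by case. Qed.
HB.instance Definition _ := Countable.copy move (can_type move_codeK).

Definition action_code (i : action) : option (nat * nat * move * move) :=
  if i is Write a b m m' then Some (a, b, m, m') else None.
Definition action_decode (o : option (nat * nat * move * move)) : action :=
  if o is Some (a, b, m, m') then Write a b m m' else Query.
Lemma action_codeK : cancel action_code action_decode. Proof. by case. Qed.
HB.instance Definition _ := Countable.copy action (can_type action_codeK).

(* An entry [((q, a, b), (i, q'))] applies in state [q] when [a] and [b] are
   the symbols scanned on the work and oracle tapes; it performs [i] and goes
   to state [q'].  The first applicable entry is the one executed, and the
   machine halts when there is none. *)
Definition machine : Type := seq ((nat * nat * nat) * (action * nat)).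

(* Contents to the left of the head (nearest cell first), scanned symbol,
   contents to the right; all other cells are blank. *)
Definition tape : Type := (seq nat * nat * seq nat)%type.

Definition unary (n : nat) : tape :=
  ([::], head 0 (nseq n 1), behead (nseq n 1)).

Definition scanned (t : tape) : nat := t.1.2.

Definition ones (t : tape) : nat :=
  let: (l, a, r) := t in count_mem 1 (l ++ a :: r).

Definition write_move (a : nat) (m : move) (t : tape) : tape :=
  let: (l, _, r) := t in
  match m with
  | MLeft => (behead l, head 0 l, a :: r)
  | MStay => (l, a, r)
  | MRight => (a :: l, head 0 r, behead r)
  end.

Definition config : Type := (nat * tape * tape)%type.

Fixpoint lookup (M : machine) (k : nat * nat * nat) : option (action * nat) :=
  if M is (k', r) :: M' then if k == k' then Some r else lookup M' k else None.

(* A query replaces the contents of the oracle tape, read as the number of 1s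
   on it, by the value of the oracle at that number, written in unary. *)
Definition step (X : type1) (M : machine) (c : config) : option config :=
  let: (q, w, o) := c in
  match lookup M (q, scanned w, scanned o) with
  | None => None
  | Some (Write a b m m', q') => Some (q', write_move a m w, write_move b m' o)
  | Some (Query, q') => Some (q', w, unary (X (ones o)))
  end.

Inductive reaches (X : type1) (M : machine) : config -> config -> Prop :=
| reaches_refl c : reaches X M c c
| reaches_step c c' c'' :
    step X M c = Some c' -> reaches X M c' c'' -> reaches X M c c''.

(* The input is given in unary on the work tape; the output is the number of
   1s on the work tape when the machine halts. *)
Definition halts_with (X : type1) (M : machine) (n m : nat) : Prop :=
  exists q w o,
    [/\ reaches X M (0, unary n, unary 0) (q, w, o),
        step X M (q, w, o) = None
      & ones w = m].

Definition nth_machine (e : nat) : machine := odflt [::] (unpickle e).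

(* [{e}^X] is total and equal to [y]. *)
Definition Turing_computes (e : nat) (X y : type1) : Prop :=
  forall n, halts_with X (nth_machine e) n (y n).

(** * Problems and N-reductions *)

(* The problem [forall Y, exists x, A Y x] is given by its matrix [A]. *)
Definition problem : Type := type2 -> type1 -> Prop.

Definition N_reduction (PB PA : problem)
    (e : nat) (s : type2 -> type1 -> type1) (t : type2 -> type2) : Prop :=
  forall (Z : type2) (x : type1),
    PA (t Z) x -> exists y, Turing_computes e (s Z x) y /\ PB Z y.

Definition N_reduces (PB PA : problem) : Prop :=
  exists (e : nat) (s : closed_term (Arr ty2 (Arr ty1 ty1)))
         (t : closed_term (Arr ty2 ty2)),
    N_reduction PB PA e (interp s) (interp t).

Definition strongly_N_reduces (PB PA : problem) : Prop :=
  exists (e : nat) (u : closed_term (Arr ty1 ty1))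
         (t : closed_term (Arr ty2 ty2)),
    N_reduction PB PA e (fun _ x => interp u x) (interp t).

(** * Pairing *)

(* [N * N^N] is identified with [N^N] by [fcons], and [N^N * N^N] by [fjoin]. *)
Definition fcons (n : nat) (f : type1) : type1 :=
  fun k => if k is k'.+1 then f k' else n.

Definition fjoin (f g : type1) : type1 :=
  fun k => if odd k then g k./2 else f k./2.

(** * The problem [exists X, X = J(Y)] *)

Definition is_char_of (x : type1) (A : set nat) : Prop :=
  forall n, (x n = 1 /\ A n) \/ (x n = 0 /\ ~ A n).

Definition J (Y : type2) : set nat :=
  [set n | exists f : type1, Y (fcons n f) = 0].

Definition J_problem : problem := fun Y x => is_char_of x (J Y).

(** * Convergence of increasing nets in Cantor space *)

Definition directed_set (I : Type) (D : set I) (le : I -> I -> Prop) : Prop :=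
  [/\ D !=set0,
      (forall a, D a -> le a a),
      (forall a b c, D a -> D b -> D c -> le a b -> le b c -> le a c)
    & (forall a b, D a -> D b -> exists c, [/\ D c, le a c & le b c])].

Definition net_converges (T : topologicalType) (I : Type) (D : set I)
    (le : I -> I -> Prop) (x : I -> T) (y : T) : Prop :=
  forall U : set T, nbhs y U ->
    exists d0, D d0 /\ forall d, D d -> le d0 d -> U (x d).

Definition le_lex (f g : cantor_space) : Prop :=
  f =1 g \/
  exists n, (forall i, i < n -> f i = g i) /\ f n = false /\ g n = true.

Definition increasing_net (I : Type) (D : set I) (le : I -> I -> Prop)
    (x : I -> cantor_space) : Prop :=
  forall a b, D a -> D b -> le a b -> le_lex (x a) (x b).

Definition binary (f : type1) : Prop := forall n, f n = 0 \/ f n = 1.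

Definition to_cantor (f : type1) : cantor_space := fun n => f n == 1.

(* A type-2 object [Z] codes three functionals, according to the first entry
   of the argument: the characteristic functions of [D] (0) and of the
   relation on [D] (1), and the map [(d, n) |-> x_d(n)] (2). *)
Definition net_dom (Z : type2) : set type1 := [set d | Z (fcons 0 d) = 1].

Definition net_le (Z : type2) (a b : type1) : Prop :=
  Z (fcons 1 (fjoin a b)) = 1.

Definition net_val (Z : type2) (d : type1) : type1 :=
  fun n => Z (fcons 2 (fcons n d)).

Definition codes_net (Z : type2) : Prop :=
  [/\ (forall d, Z (fcons 0 d) = 0 \/ Z (fcons 0 d) = 1),
      (forall a b, net_dom Z a -> net_dom Z b ->
         Z (fcons 1 (fjoin a b)) = 0 \/ Z (fcons 1 (fjoin a b)) = 1),
      (forall d, net_dom Z d -> binary (net_val Z d))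
    & directed_set (net_dom Z) (net_le Z)].

Definition monotone_net_problem : problem := fun Z x =>
  codes_net Z ->
  increasing_net (net_dom Z) (net_le Z) (fun d => to_cantor (net_val Z d)) ->
  binary x /\
  net_converges (net_dom Z) (net_le Z) (fun d => to_cantor (net_val Z d))
    (to_cantor x).

(* Main.v *)
(** An increasing net that computes the jump of [Y] must have an order that is
  decidable relative to [Y] in system T, so its indices cannot be compared as
  functions.  An index is instead a number [k] together with one candidate
  witness for every [n]; its value is the set of those [n < k] whose candidate
  is correct, and indices are compared by [k] and by these finite sets.  The
  limit of this net is the jump.

  Conversely, the limit of an increasing net is found digit by digit: once the
  prefix [s] is known, the next digit is 1 iff some value of the net extends
  [s] followed by 1, because by monotonicity the net can then never leave that
  neighbourhood of [s].  These queries are answered by one jump. *)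

From mathcomp Require Import all_boot zify.
From mathcomp Require Import boolp classical_sets topology cantor.
Require Import Defs.

Set Implicit Arguments.
Unset Strict Implicit.
Unset Printing Implicit Defensive.

Local Open Scope classical_set_scope.

(** * Convergence of nets in Cantor space, coordinate by coordinate *)

(** The sets containing a tail of the net form a filter, by directedness, and the product topology
    is generated by the projections, so single coordinates suffice. *)
Lemma cantor_net_convergesP (I : Type) (D : set I) (le : I -> I -> Prop)
    (x : I -> cantor_space) (y : cantor_space) :
  directed_set D le ->
  net_converges D le x y <->
  forall n, exists d0, D d0 /\ forall d, D d -> le d0 d -> x d n = y n.
Proof.
move=> [[a0 Da0] _ le_trans le_dir]; split=> [cvx n|cvx].
  apply: (cvx [set z : cantor_space | z n = y n]).
  exact: (@proj_continuous nat (fun=> bool) n y _ (discrete_set1 (y n))).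
pose F : set_system cantor_space :=
  [set U | exists d0, D d0 /\ forall d, D d -> le d0 d -> U (x d)].
have FF : Filter F.
  split=> [|P Q [d1 [Dd1 Pd1]] [d2 [Dd2 Qd2]]|P Q PQ [d0 [Dd0 Pd0]]].
  - by exists a0.
  - have [d [Dd le1 le2]] := le_dir _ _ Dd1 Dd2.
    exists d; split=> // e De lede; split.
      by apply: Pd1 => //; exact: le_trans lede.
    by apply: Qd2 => //; exact: le_trans lede.
  - by exists d0; split=> // d Dd led; apply: PQ; exact: Pd0.
suff: F --> y by [].
apply/cvg_sup => n U [V [[W _ <-] Wyn WU]].
have [d0 [Dd0 xd0]] := cvx n.
by exists d0; split=> // d Dd led; apply: WU; rewrite /= xd0.
Qed.

(** * A machine that outputs its oracle *)

(* State 0 moves the input to the oracle tape, state 1 moves the answer back. *)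
Definition oracle_machine : machine :=
  [:: ((0, 1, 0), (Write 0 1 MRight MRight, 0));
      ((0, 0, 0), (Query, 1));
      ((1, 0, 1), (Write 1 0 MRight MRight, 1))].

Lemma reaches_trans X M c1 c2 c3 :
  reaches X M c1 c2 -> reaches X M c2 c3 -> reaches X M c1 c3.
Proof.
by elim=> // c c' c'' cc' _ IH /IH; exact: reaches_step.
Qed.

(** Loop invariant: [i] symbols are already moved and [k] remain. *)
Lemma oracle_machine_read X i k :
  reaches X oracle_machine
    (0, (nseq i 0, head 0 (nseq k 1), behead (nseq k 1)),
        (nseq i 1, 0, [::]))
    (0, (nseq (i + k) 0, 0, [::]), (nseq (i + k) 1, 0, [::])).
Proof.
elim: k i => [|k IH] i; first by rewrite addn0; exact: reaches_refl.
by eapply reaches_step; [reflexivity|]; rewrite addnS -addSn; exact: (IH i.+1).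
Qed.

Lemma oracle_machine_write X l l' i k :
  reaches X oracle_machine
    (1, (nseq i 1 ++ l, 0, [::]),
        (nseq i 0 ++ l', head 0 (nseq k 1), behead (nseq k 1)))
    (1, (nseq (i + k) 1 ++ l, 0, [::]), (nseq (i + k) 0 ++ l', 0, [::])).
Proof.
elim: k i => [|k IH] i; first by rewrite addn0; exact: reaches_refl.
by eapply reaches_step; [reflexivity|]; rewrite addnS -addSn; exact: (IH i.+1).
Qed.

(** Both reductions do their real work in system T; the machine only copies the result. *)
Lemma oracle_machine_computes X : Turing_computes (pickle oracle_machine) X X.
Proof.
move=> n; rewrite /nth_machine pickleK /=.
exists 1, (nseq (X n) 1 ++ nseq n 0, 0, [::]), (nseq (X n) 0, 0, [::]); split.
- apply: reaches_trans (oracle_machine_read X 0 n) _.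
  eapply reaches_step; [reflexivity|]; rewrite add0n.
  have -> : ones (nseq n 1, 0, [::]) = n.
    by rewrite /ones count_cat count_nseq /=; lia.
  have := oracle_machine_write X (nseq n 0) [::] 0 (X n).
  by rewrite !cats0 add0n; exact.
- by [].
- by rewrite /ones !count_cat !count_nseq /=; lia.
Qed.

(** * Basic arithmetic in system T *)

Local Notation "f <@> u" := (App f u) (at level 40, left associativity).
Local Notation v0 := (Var (VZ _ _)).
Local Notation v1 := (Var (VS _ (VZ _ _))).
Local Notation v2 := (Var (VS _ (VS _ (VZ _ _)))).
Local Notation v3 := (Var (VS _ (VS _ (VS _ (VZ _ _))))).
Local Notation rec x g n := (Rec _ _ <@> x <@> g <@> n).
Local Notation succ n := (Succ _ <@> n).

Definition pred_term {G} : term G (Arr Nat Nat) :=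
  Lam (rec (Zero _) (Lam (Lam v1)) v0).

(* The first branch is taken when the test is 0. *)
Definition if_term {G} : term G (Arr Nat (Arr Nat (Arr Nat Nat))) :=
  Lam (Lam (Lam (rec v1 (Lam (Lam v2)) v2))).

Definition add_term {G} : term G (Arr Nat (Arr Nat Nat)) :=
  Lam (Lam (rec v1 (Lam (Lam (succ v0))) v0)).

Definition sub_term {G} : term G (Arr Nat (Arr Nat Nat)) :=
  Lam (Lam (rec v1 (Lam (Lam (pred_term <@> v0))) v0)).

Definition double_term {G} : term G (Arr Nat Nat) :=
  Lam (add_term <@> v0 <@> v0).

Definition fcons_term {G} : term G (Arr Nat (Arr ty1 ty1)) :=
  Lam (Lam (Lam (rec v2 (Lam (Lam (v3 <@> v1))) v0))).

Definition all_term {G} : term G (Arr ty1 (Arr Nat Nat)) :=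
  Lam (Lam (rec (succ (Zero _))
    (Lam (Lam (if_term <@> (v3 <@> v1) <@> v0 <@> Zero _))) v0)).

Lemma pred_termE n : interp pred_term n = n.-1.
Proof. by case: n. Qed.

Lemma if_termE n a b : interp if_term n a b = if n == 0 then a else b.
Proof. by case: n. Qed.

Lemma add_termE m n : interp add_term m n = m + n.
Proof.
elim: n => [|n IH]; first by rewrite addn0.
by rewrite addnS -IH.
Qed.

Lemma sub_termE m n : interp sub_term m n = m - n.
Proof.
elim: n => [|n IH]; first by rewrite subn0.
by rewrite subnS -IH -pred_termE.
Qed.

Lemma double_termE n : interp double_term n = n.*2.
Proof. by rewrite -addnn -add_termE. Qed.

Lemma fcons_termE n f : interp fcons_term n f = fcons n f.
Proof. by apply/funext => -[|k]. Qed.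

Lemma all_termE p n :
  interp all_term p n = all (fun i => p i == 0) (iota 0 n) :> nat.
Proof.
elim: n => // n IH; rewrite -addn1 iotaD all_cat /= andbT addn1.
rewrite (_ : interp all_term p n.+1 =
  interp if_term (p n) (interp all_term p n) 0) // if_termE IH.
by case: (p n == 0); rewrite ?andbT ?andbF.
Qed.

(** * From the jump to increasing nets *)

(* [d] codes the number [d 0] and the candidate witnesses [slot d n] for all
   [n], the indices [2 ^ n * (2 m + 1)] being positive and pairwise distinct. *)
Definition slot (d : type1) (n : nat) : type1 :=
  fun m => d (2 ^ n * m.*2.+1).

(** For positive [j], the 2-adic valuation gives back [n] and the odd part gives back [m]. *)
Definition unslot (k : nat) (w : nat -> type1) : type1 :=
  fun j => if j == 0 then k else w (logn 2 j) (j %/ 2 ^ logn 2 j)./2.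

Lemma slot_unslot k w n : slot (unslot k w) n = w n.
Proof.
apply/funext => m; rewrite /slot /unslot muln_eq0 expn_eq0 /=.
rewrite lognM ?expn_gt0 // pfactorK // (@lognE 2 m.*2.+1) dvdn2 /=.
by rewrite odd_double /= addn0 mulKn ?expn_gt0 //= uphalf_double.
Qed.

Definition stage (Y : type2) (d : type1) (n : nat) : bool :=
  (n < d 0) && (Y (fcons n (slot d n)) == 0).

Definition stage_le (Y : type2) (a b : type1) : bool :=
  (a 0 <= b 0) && all (fun n => stage Y a n <= stage Y b n) (iota 0 (a 0)).

Definition slot_term {G} : term G (Arr ty1 (Arr Nat ty1)) :=
  Lam (Lam (Lam (v2 <@> rec (succ (double_term <@> v0))
    (Lam (Lam (double_term <@> v0))) v1))).

Definition stage_term {G} : term G (Arr ty2 (Arr ty1 ty1)) :=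
  Lam (Lam (Lam (if_term <@> (sub_term <@> succ v0 <@> (v1 <@> Zero _))
    <@> (if_term <@> (v2 <@> (fcons_term <@> v0 <@> (slot_term <@> v1 <@> v0)))
           <@> succ (Zero _) <@> Zero _)
    <@> Zero _))).

Definition stage_le_term {G} : term G (Arr ty2 (Arr ty1 (Arr ty1 Nat))) :=
  Lam (Lam (Lam (if_term <@> (sub_term <@> (v1 <@> Zero _) <@> (v0 <@> Zero _))
    <@> (all_term <@> Lam (sub_term <@> (stage_term <@> v3 <@> v2 <@> v0)
                                    <@> (stage_term <@> v3 <@> v1 <@> v0))
                  <@> (v1 <@> Zero _))
    <@> Zero _))).

(** The tag 0 selects the domain, which is everything, the tag 1 the order, any other tag the
    values. In the order branch, the two inner abstractions undo [fjoin], with positions shifted by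
    one for the tag. *)
Definition stage_net_term : closed_term (Arr ty2 ty2) :=
  Lam (Lam (if_term <@> (v0 <@> Zero _) <@> succ (Zero _) <@>
    (if_term <@> (pred_term <@> (v0 <@> Zero _))
       <@> (stage_le_term <@> v1
              <@> Lam (v1 <@> succ (double_term <@> v0))
              <@> Lam (v1 <@> succ (succ (double_term <@> v0))))
       <@> (stage_term <@> v1 <@> Lam (v1 <@> succ (succ v0))
              <@> (v0 <@> succ (Zero _)))))).

Lemma slot_termE d n : interp slot_term d n = slot d n.
Proof.
apply/funext => m; congr (d _); elim: n => [|n IH].
  by rewrite mul1n -double_termE.
by rewrite expnS -mulnA mul2n -IH -double_termE.
Qed.

Lemma stage_termE Y d n : interp stage_term Y d n = stage Y d n.
Proof.
transitivity (interp if_term (interp sub_term n.+1 (d 0)) (interp if_term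
  (Y (interp fcons_term n (interp slot_term d n))) 1 0) 0) => //.
rewrite slot_termE fcons_termE sub_termE !if_termE subn_eq0 /stage.
by case: ltnP => //=; case: eqP.
Qed.

Lemma stage_le_termE Y a b : interp stage_le_term Y a b = stage_le Y a b.
Proof.
transitivity (interp if_term (interp sub_term (a 0) (b 0))
  (interp all_term (fun n => interp sub_term (interp stage_term Y a n)
     (interp stage_term Y b n)) (a 0)) 0) => //.
rewrite if_termE sub_termE subn_eq0 /stage_le; case: leqP => //= _.
rewrite all_termE; congr (nat_of_bool _); apply: eq_all => n.
by rewrite sub_termE subn_eq0 !stage_termE.
Qed.

Lemma stage_net_dom Y d : interp stage_net_term Y (fcons 0 d) = 1.
Proof. by []. Qed.

Lemma stage_net_le Y a b :
  interp stage_net_term Y (fcons 1 (fjoin a b)) = stage_le Y a b.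
Proof.
rewrite -stage_le_termE.
transitivity (interp stage_le_term Y
  (fun k => fjoin a b (interp double_term k))
  (fun k => fjoin a b (interp double_term k).+1)) => //.
rewrite (_ : (fun k => _) = a); last first.
  by apply/funext => k; rewrite double_termE /fjoin odd_double doubleK.
rewrite (_ : (fun k => _) = b) //.
by apply/funext => k; rewrite double_termE /fjoin /= odd_double uphalf_double.
Qed.

Lemma stage_net_val Y d : net_val (interp stage_net_term Y) d = stage Y d.
Proof. by apply/funext => n; rewrite -stage_termE. Qed.

(** A bounded test suffices because [stage Y a n] forces [n < a 0]. *)
Lemma stage_leP Y a b : reflect
  (a 0 <= b 0 /\ forall n, stage Y a n -> stage Y b n) (stage_le Y a b).
Proof.
apply: (iffP andP) => -[le_ab H]; split=> //.
  move=> n Yan; have n_lt : n < a 0 by case/andP: Yan.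
  have /allP/(_ n) := H; rewrite mem_iota add0n => /(_ n_lt).
  by rewrite Yan; case: stage.
by apply/allP => n _; case: (stage Y a n) (H n) => // ->.
Qed.

Lemma stage_net_directed Y :
  directed_set (net_dom (interp stage_net_term Y))
               (net_le (interp stage_net_term Y)).
Proof.
have leE a b : net_le (interp stage_net_term Y) a b <-> stage_le Y a b.
  by rewrite /net_le stage_net_le; case: stage_le.
split=> [|a _|a b c _ _ _|a b _ _].
- by exists id.
- by apply/leE/stage_leP.
- move=> /leE/stage_leP[ab0 ab] /leE/stage_leP[bc0 bc].
  apply/leE/stage_leP; split; first exact: leq_trans bc0.
  by move=> n /ab/bc.
(* For each [n], the bound keeps the candidate of [a] where it is correct and takes that of [b]
   elsewhere. *)
- pose c := unslot (maxn (a 0) (b 0))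
    (fun n => if stage Y a n then slot a n else slot b n).
  have cE n : slot c n = if stage Y a n then slot a n else slot b n.
    exact: slot_unslot.
  exists c; split=> //; apply/leE/stage_leP; split.
  + exact: leq_maxl.
  + move=> n Yan; move: (Yan); rewrite /stage cE Yan => /andP[n_lt ->].
    by rewrite andbT; exact: leq_trans n_lt (leq_maxl _ _).
  + exact: leq_maxr.
  + move=> n /andP[n_lt Ybn]; apply/andP; split.
      exact: leq_trans n_lt (leq_maxr _ _).
    by rewrite cE; case: ifP => // /andP[].
Qed.

Lemma stage_net_codes Y : codes_net (interp stage_net_term Y).
Proof.
split=> [d|a b _ _|d _ n|]; last exact: stage_net_directed.
- by rewrite stage_net_dom; right.
- by rewrite stage_net_le; case: stage_le; [right|left].
- by rewrite stage_net_val; case: stage; [right|left].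
Qed.

(** At the first difference, inclusion leaves only 0 against 1. *)
Lemma le_lex_pointwise (f g : cantor_space) :
  (forall n, f n -> g n) -> le_lex f g.
Proof.
move=> le_fg; have [[n neq_fg]|eq_fg] := pselect (exists n, f n != g n).
  right; pose m := ex_minn (ex_intro (fun n => f n != g n) n neq_fg).
  have [neq_m min_m] : f m != g m /\ forall i, i < m -> f i = g i.
    rewrite /m; case: ex_minnP => k neq_k min_k; split=> // i i_lt.
    by apply/eqP; apply: contraLR i_lt => /min_k; rewrite -leqNgt.
  exists m; split=> //.
  by move: neq_m (le_fg m); case: (f m) (g m) => [] [] // _ ->.
by left=> n; apply/eqP/negPn/negP => neq_n; apply: eq_fg; exists n.
Qed.

Lemma to_cantor_stage Y d : to_cantor (stage Y d) = stage Y d :> (nat -> bool).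
Proof. by apply/funext => n; rewrite /to_cantor; case: stage. Qed.

Lemma stage_net_increasing Y :
  increasing_net (net_dom (interp stage_net_term Y))
    (net_le (interp stage_net_term Y))
    (fun d => to_cantor (net_val (interp stage_net_term Y) d)).
Proof.
move=> a b _ _; rewrite /net_le stage_net_le !stage_net_val !to_cantor_stage.
case: stage_leP => // -[_ le_ab] _; exact: le_lex_pointwise.
Qed.

(** The limit is already the characteristic function of the jump, so the term applied to it is the
    identity. *)
Lemma J_reduces_to_monotone_net :
  strongly_N_reduces J_problem monotone_net_problem.
Proof.
exists (pickle oracle_machine), (Lam (Var (VZ _ _))), stage_net_term.
move=> Y x /(_ (stage_net_codes Y) (stage_net_increasing (Y := Y)))[x01].
have dirY := stage_net_directed Y.
move=> /(cantor_net_convergesP _ _ dirY) cvx.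
exists x; split=> [|n]; first exact: oracle_machine_computes.
have [d0 [_ /= xn]] := cvx n; rewrite /to_cantor in xn.
have stageE d : net_le (interp stage_net_term Y) d0 d ->
    stage Y d n = (x n == 1).
  by move=> /(xn d (stage_net_dom Y d)); rewrite stage_net_val; case: stage.
case: (x01 n) stageE => -> stageE; [right|left]; split=> //.
  move=> [f Yf]; have [_ _ _ dir] := dirY.
  (* The number [n.+1] admits [n]. An upper bound of [d0] and [d] must then contain [n], though past
     [d0] the digit is 0. *)
  pose d := unslot n.+1 (fun=> f).
  have [c [_ le0 le1]] := dir d0 d (stage_net_dom Y d0) (stage_net_dom Y d).
  have Yd : stage Y d n.
    by rewrite /stage (slot_unslot n.+1 (fun=> f)) Yf ltnS leqnn.
  move: le1; rewrite /net_le stage_net_le.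
  by case: stage_leP => // -[_ /(_ n Yd)]; rewrite (stageE c le0).
have [_ refl _ _] := dirY.
have := stageE d0 (refl d0 (stage_net_dom Y d0)).
by case/andP=> _ /eqP Yd0; exists (slot d0 n).
Qed.

(** * From increasing nets to the jump *)

(** The leading 1 keeps words that differ only by initial zeros apart. *)
Fixpoint prefix_code (f : type1) (n : nat) : nat :=
  if n is m.+1 then (prefix_code f m).*2 + f m else 1.

Lemma prefix_code_gt0 f n : 0 < prefix_code f n.
Proof. by elim: n => //= n; lia. Qed.

Lemma eq_prefix_code f g n :
  (forall i, i < n -> f i = g i) -> prefix_code f n = prefix_code g n.
Proof.
elim: n => //= n IH eq_fg; rewrite IH ?eq_fg // => i i_lt.
by apply: eq_fg; exact: ltnW.
Qed.

Lemma prefix_code_inj f g m n : binary f -> binary g ->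
  prefix_code f m = prefix_code g n ->
  m = n /\ forall i, i < n -> f i = g i.
Proof.
move=> f01 g01; elim: m n => [|m IH] [|n] //=.
- by have := prefix_code_gt0 g n; lia.
- by have := prefix_code_gt0 f m; lia.
- move=> eq_c; have eq_mn : f m = g n.
    by case: (f01 m) (g01 n) => -> [] -> in eq_c *; lia.
  have [|eqmn eq_fg] := IH n; first by lia.
  by subst m; split=> // i; rewrite ltnS leq_eqVlt => /predU1P[->|/eq_fg].
Qed.

Definition prefix_code_term {G} : term G (Arr ty1 (Arr Nat Nat)) :=
  Lam (Lam (rec (succ (Zero _))
    (Lam (Lam (add_term <@> (double_term <@> v0) <@> (v3 <@> v1)))) v0)).

Definition dist_term {G} : term G (Arr Nat (Arr Nat Nat)) :=
  Lam (Lam (add_term <@> (sub_term <@> v1 <@> v0) <@> (sub_term <@> v0 <@> v1))).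

(* At [fcons m (fcons k d)] this vanishes iff [d] is in the domain and [m] is
   the code of the first [k] entries of the value of the net at [d]. *)
Definition prefix_search_term : closed_term (Arr ty2 ty2) :=
  Lam (Lam (add_term
    <@> (dist_term
           <@> (v1 <@> (fcons_term <@> Zero _ <@> Lam (v1 <@> succ (succ v0))))
           <@> succ (Zero _))
    <@> (dist_term
           <@> (prefix_code_term
                  <@> Lam (v2 <@> (fcons_term <@> succ (succ (Zero _))
                        <@> (fcons_term <@> v0 <@> Lam (v2 <@> succ (succ v0)))))
                  <@> (v0 <@> succ (Zero _)))
           <@> (v0 <@> Zero _)))).

(* The next digit of the limit is 1 iff the prefix found so far, followed by
   1, is a prefix of some value of the net. *)
Definition limit_term : closed_term (Arr ty1 ty1) :=
  Lam (Lam (v1 <@> succ (double_term <@> rec (succ (Zero _))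
    (Lam (Lam (add_term <@> (double_term <@> v0)
                        <@> (v3 <@> succ (double_term <@> v0))))) v0))).

Lemma prefix_code_termE f n : interp prefix_code_term f n = prefix_code f n.
Proof.
elim: n => //= n <-.
by rewrite -double_termE -add_termE.
Qed.

Lemma dist_term_eq0 m n : interp dist_term m n = 0 <-> m = n.
Proof.
rewrite (_ : interp dist_term m n =
  interp add_term (interp sub_term m n) (interp sub_term n m)) //.
by rewrite add_termE !sub_termE; lia.
Qed.

Lemma prefix_search_termP Z m : J (interp prefix_search_term Z) m <->
  exists k d, net_dom Z d /\ prefix_code (net_val Z d) k = m.
Proof.
have searchE k d : interp prefix_search_term Z (fcons m (fcons k d)) = 0 <->
    net_dom Z d /\ prefix_code (net_val Z d) k = m.
  rewrite (_ : interp prefix_search_term Z (fcons m (fcons k d)) =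
    interp add_term (interp dist_term (Z (interp fcons_term 0 d)) 1)
      (interp dist_term (interp prefix_code_term
        (fun n => Z (interp fcons_term 2 (interp fcons_term n d))) k) m)) //.
  rewrite add_termE fcons_termE prefix_code_termE.
  rewrite (_ : (fun n => _) = net_val Z d); last first.
    by apply/funext => n; rewrite !fcons_termE.
  rewrite /net_dom /= -(dist_term_eq0 (Z _)) -(dist_term_eq0 (prefix_code _ _)).
  by lia.
split=> [[f Yf]|[k [d /searchE Yd]]]; last by exists (fcons k d).
exists (f 0), (fun i => f i.+1); apply/searchE.
by rewrite -[RHS]Yf; congr (interp prefix_search_term Z (fcons m _));
   apply/funext => -[].
Qed.

(** The recursor rebuilds the code of the digits already produced; appending the digit 1 to code [c]
    gives [c.*2.+1]. *)
Lemma limit_termE x n :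
  interp limit_term x n = x (prefix_code (interp limit_term x) n).*2.+1.
Proof.
rewrite -double_termE; congr (x (interp double_term _).+1).
by elim: n => //= n <-; rewrite -double_termE -add_termE.
Qed.

Lemma binary_limit_term x A : is_char_of x A -> binary (interp limit_term x).
Proof.
move=> xA n; rewrite limit_termE.
by case: (xA (prefix_code (interp limit_term x) n).*2.+1) => -[-> _]; auto.
Qed.

(** A first difference before [n] is excluded, one at [n] makes [g n] true, and a later one leaves
    the digit at [n] equal. *)
Lemma le_lex_next_bit (f g : cantor_space) n :
  (forall i, i < n -> f i = g i) -> le_lex f g -> f n -> g n.
Proof.
move=> eq_fg [->//|[m [eq_m [fm gm]]]] fn.
case: (ltngtP n m) => [/eq_m <- //|/eq_fg|eq_nm]; first by rewrite fm gm.
by rewrite eq_nm.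
Qed.

(** Whole prefixes are stabilised, not single digits, since the lexicographic order controls digit
    [n] only once the earlier ones agree. *)
Lemma net_limit_prefix Z x : J_problem (interp prefix_search_term Z) x ->
  codes_net Z ->
  increasing_net (net_dom Z) (net_le Z) (fun d => to_cantor (net_val Z d)) ->
  forall n, exists d0, net_dom Z d0 /\ forall d, net_dom Z d -> net_le Z d0 d ->
    forall i, i < n -> net_val Z d i = interp limit_term x i.
Proof.
move=> xJ [_ _ Z01 [[a0 Da0] le_refl le_trans le_dir]] incZ.
set y := interp limit_term x.
have y01 : binary y by exact: binary_limit_term xJ.
elim=> [|n [d0 [Dd0 eq_d0]]]; first by exists a0.
have yn : y n = x (prefix_code y n).*2.+1 by exact: limit_termE.
case: (xJ (prefix_code y n).*2.+1); rewrite -yn => -[yn01].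
  (* The code is at least 3, which excludes the empty prefix; by parity the last digit is 1. *)
  move=> /prefix_search_termP[[|k] [d [Dd /= codeE]]].
    by have := prefix_code_gt0 y n; lia.
  have [dk1 codeE'] : net_val Z d k = 1 /\
      prefix_code (net_val Z d) k = prefix_code y n.
    by case: (Z01 d Dd k) => dk; rewrite dk in codeE *; lia.
  have [eq_kn eq_dy] := prefix_code_inj (Z01 d Dd) y01 codeE'.
  (* Past [c], [d0] fixes the first [n] digits and monotonicity above [d] preserves the 1 that
     follows. *)
  have [c [Dc le0c ledc]] := le_dir _ _ Dd0 Dd.
  exists c; split=> // e De lece i; rewrite ltnS leq_eqVlt.
  have le0e : net_le Z d0 e by exact: le_trans lece.
  have lede : net_le Z d e by exact: le_trans lece.
  case/predU1P=> [->|]; last exact: eq_d0.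
  rewrite yn01; apply/eqP.
  apply: (le_lex_next_bit _ (incZ _ _ Dd De lede)); last first.
    by rewrite /to_cantor -eq_kn dk1.
  by move=> j j_lt; rewrite /to_cantor eq_dy // eq_d0.
(* Here [d0] still serves: a later value with digit 1 at [n] would be a positive answer to the
   query. *)
move=> notJ; exists d0; split=> // e De le0e i; rewrite ltnS leq_eqVlt.
case/predU1P=> [->|]; last exact: eq_d0.
rewrite yn01; case: (Z01 e De n) => // en1; case: notJ.
apply/prefix_search_termP; exists n.+1, e; split=> //=.
by rewrite en1 (eq_prefix_code (eq_d0 e De le0e)) addn1.
Qed.

(** One jump answers the queries for all prefixes, so the limit is computed without further access
    to the net and the reduction is strong. *)
Lemma monotone_net_reduces_to_J :
  strongly_N_reduces monotone_net_problem J_problem.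
Proof.
exists (pickle oracle_machine), limit_term, prefix_search_term => Z x xJ.
exists (interp limit_term x); split=> [|codesZ incZ].
  exact: oracle_machine_computes.
split; first exact: binary_limit_term xJ.
have [_ _ _ dirZ] := codesZ.
apply/(cantor_net_convergesP _ _ dirZ) => n.
have [d0 [Dd0 eq_d0]] := net_limit_prefix xJ codesZ incZ n.+1.
by exists d0; split=> // d Dd le0d; rewrite /to_cantor (eq_d0 d).
Qed.

Theorem theorem1 :
  strongly_N_reduces J_problem monotone_net_problem /\
  strongly_N_reduces monotone_net_problem J_problem.
Proof.
split; [exact: J_reduces_to_monotone_net|exact: monotone_net_reduces_to_J].
Qed.
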